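(* Let $L$ be the free Lie algebra over $\mathbb{C}$ on generators $a,b,c$, with $\mathfrak{sl}_2(\mathbb{C})$ acting on $L$ by derivations extending the adjoint representation on $L_1=\mathrm{span}\{a,b,c\}$. Then the space of Lie invariants of degree 5 (a subspace of $L_5$) has dimension 1 and basis $$I_5 = [[[ba]b][cb]] + 4[[[ba]c][ca]] + 2[[[ca]a][cb]] - 2[[[ca]b][ca]] - 2[[[ca]c][ba]] - [[[cb]b][ba]].$$
   Context: $L=\bigoplus_{n\ge1}L_n$ is the grading of the free Lie algebra by degree (each generator has degree 1). $\mathfrak{sl}_2(\mathbb{C})$ has standard basis $x,h,y$ with $[h,x]=2x$, $[h,y]=-2y$, $[x,y]=h$. The space $L_1$ is regarded as the adjoint representation by identifying $a,b,c$ with $x,h,y$ respectively, so that $x.a=0$, $x.b=-2a$, $x.c=b$; $h.a=2a$, $h.b=0$, $h.c=-2c$; $y.a=-b$, $y.b=2c$, $y.c=0$. The action extends to all of $L$ by the derivation rule $D.[t,u]=[D.t,u]+[t,D.u]$ for $D\in\mathfrak{sl}_2(\mathbb{C})$. A Lie invariant of degree $j$ is an element $Z\in L_j$ with $D.Z=0$ for all $D\in\mathfrak{sl}_2(\mathbb{C})$. Commas are omitted in Lie brackets: $[uv]$ means $[u,v]$; e.g. $[[[ba]b][cb]]=[[[b,a],b],[c,b]]$. *)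

(* Defs.v *)
From HB Require Import structures.
From mathcomp Require Import all_boot all_order all_algebra.
From mathcomp Require Import boolp classical_sets reals complex.

Set Implicit Arguments.
Unset Strict Implicit.
Unset Printing Implicit Defensive.

Import Order.TTheory GRing.Theory Num.Theory.

Local Open Scope quotient_scope.
Local Open Scope ring_scope.

HB.mixin Record Lmodule_isLieAlgebra (K : comNzRingType) L
    of GRing.Lmodule K L := {
  lieb : L -> L -> L;
  lieb_linearl : forall v : L, linear (lieb^~ v);
  lieb_linearr : forall u : L, linear (lieb u);
  liebxx : forall u : L, lieb u u = 0;
  lieb_jacobi : forall u v w : L,
    lieb u (lieb v w) + lieb v (lieb w u) + lieb w (lieb u v) = 0
}.

#[short(type="lieAlgType")]
HB.structure Definition LieAlgebra (K : comNzRingType) :=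
  { L of GRing.Lmodule K L & Lmodule_isLieAlgebra K L }.

Notation "[lie u , v ]" := (lieb u v)
  (at level 0, u, v at level 99, format "[lie  u ,  v ]") : ring_scope.

(* The free Lie algebra on X: formal expressions in the Lie algebra
   operations, modulo the least congruence containing the axioms. *)
Section FreeLie.
Variables (K : comNzRingType) (X : Type).

Inductive lexpr :=
| EGen of X
| EZero
| EAdd of lexpr & lexpr
| EScale of K & lexpr
| EBr of lexpr & lexpr.

HB.instance Definition _ := gen_eqMixin lexpr.
HB.instance Definition _ := gen_choiceMixin lexpr.

Inductive lrel : lexpr -> lexpr -> Prop :=
| lrel_refl u : lrel u u
| lrel_sym u v : lrel u v -> lrel v u
| lrel_trans u v w : lrel u v -> lrel v w -> lrel u w
| lrel_add u u' v v' : lrel u u' -> lrel v v' -> lrel (EAdd u v) (EAdd u' v')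
| lrel_scale k u u' : lrel u u' -> lrel (EScale k u) (EScale k u')
| lrel_br u u' v v' : lrel u u' -> lrel v v' -> lrel (EBr u v) (EBr u' v')
| lrel_addA u v w : lrel (EAdd u (EAdd v w)) (EAdd (EAdd u v) w)
| lrel_addC u v : lrel (EAdd u v) (EAdd v u)
| lrel_add0 u : lrel (EAdd EZero u) u
| lrel_addN u : lrel (EAdd (EScale (-1) u) u) EZero
| lrel_scaleA k l u : lrel (EScale k (EScale l u)) (EScale (k * l) u)
| lrel_scale1 u : lrel (EScale 1 u) u
| lrel_scaleDr k u v :
    lrel (EScale k (EAdd u v)) (EAdd (EScale k u) (EScale k v))
| lrel_scaleDl k l u :
    lrel (EScale (k + l) u) (EAdd (EScale k u) (EScale l u))
| lrel_brDl u u' v : lrel (EBr (EAdd u u') v) (EAdd (EBr u v) (EBr u' v))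
| lrel_brDr u v v' : lrel (EBr u (EAdd v v')) (EAdd (EBr u v) (EBr u v'))
| lrel_brZl k u v : lrel (EBr (EScale k u) v) (EScale k (EBr u v))
| lrel_brZr k u v : lrel (EBr u (EScale k v)) (EScale k (EBr u v))
| lrel_brxx u : lrel (EBr u u) EZero
| lrel_jacobi u v w :
    lrel (EAdd (EAdd (EBr u (EBr v w)) (EBr v (EBr w u))) (EBr w (EBr u v)))
         EZero.

Definition lrelb : rel lexpr := fun u v => `[< lrel u v >].

Lemma lrelb_equiv : equiv_class_of lrelb.
Proof.
split=> [u|u v|v u w].
- by apply/asboolP; exact: lrel_refl.
- by apply/asboolP/asboolP; exact: lrel_sym.
- by move=> /asboolP uv /asboolP vw; apply/asboolP; exact: lrel_trans uv vw.
Qed.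

Canonical lrelb_equiv_rel := EquivRelPack lrelb_equiv.

Definition free_lie := {eq_quot lrelb}.

HB.instance Definition _ := Choice.on free_lie.
HB.instance Definition _ := EqQuotient.on free_lie.

Definition lpi (u : lexpr) : free_lie := \pi_free_lie u.

Lemma lpiP u v : lpi u = lpi v <-> lrel u v.
Proof.
split=> [/eqmodP /asboolP //|uv].
by apply/eqmodP/asboolP.
Qed.

Lemma reprK' (t : free_lie) : lpi (repr t) = t.
Proof. exact: reprK. Qed.

Lemma free_lie_lpi (t : free_lie) : exists u, t = lpi u.
Proof. by exists (repr t); rewrite reprK'. Qed.

Definition gen (x : X) : free_lie := lpi (EGen x).
Definition fl_add (s t : free_lie) := lpi (EAdd (repr s) (repr t)).
Definition fl_scale k (t : free_lie) := lpi (EScale k (repr t)).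
Definition fl_br (s t : free_lie) := lpi (EBr (repr s) (repr t)).

Lemma fl_addE u v : fl_add (lpi u) (lpi v) = lpi (EAdd u v).
Proof. by apply/lpiP/lrel_add; apply/lpiP; rewrite reprK'. Qed.

Lemma fl_scaleE k u : fl_scale k (lpi u) = lpi (EScale k u).
Proof. by apply/lpiP/lrel_scale; apply/lpiP; rewrite reprK'. Qed.

Lemma fl_brE u v : fl_br (lpi u) (lpi v) = lpi (EBr u v).
Proof. by apply/lpiP/lrel_br; apply/lpiP; rewrite reprK'. Qed.

Ltac fl_axiom t :=
  repeat (let u := fresh "u" in
    move=> u; try (case: (free_lie_lpi u) => {u} u ->));
  rewrite ?(fl_addE, fl_scaleE, fl_brE); apply/lpiP; apply: t.

Lemma fl_addA : associative fl_add.
Proof. fl_axiom lrel_addA. Qed.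

Lemma fl_addC : commutative fl_add.
Proof. fl_axiom lrel_addC. Qed.

Lemma fl_add0 : left_id (lpi EZero) fl_add.
Proof. fl_axiom lrel_add0. Qed.

Lemma fl_addN : left_inverse (lpi EZero) (fl_scale (-1)) fl_add.
Proof. fl_axiom lrel_addN. Qed.

HB.instance Definition _ :=
  GRing.isZmodule.Build free_lie fl_addA fl_addC fl_add0 fl_addN.

Lemma fl_scaleA k l t : fl_scale k (fl_scale l t) = fl_scale (k * l) t.
Proof. by move: k l t; fl_axiom lrel_scaleA. Qed.

Lemma fl_scale1 : left_id 1 fl_scale.
Proof. fl_axiom lrel_scale1. Qed.

Lemma fl_scaleDr : right_distributive fl_scale +%R.
Proof. rewrite /GRing.add/=; fl_axiom lrel_scaleDr. Qed.

Lemma fl_scaleDl t : {morph fl_scale^~ t : k l / k + l}.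
Proof.
by case: (free_lie_lpi t) => u -> k l; rewrite /= !fl_scaleE [RHS]fl_addE;
  apply/lpiP; exact: lrel_scaleDl.
Qed.

HB.instance Definition _ := GRing.Zmodule_isLmodule.Build K free_lie
  fl_scaleA fl_scale1 fl_scaleDr fl_scaleDl.

Lemma lpi0 : lpi EZero = 0. Proof. by []. Qed.
Lemma lpiD u v : lpi (EAdd u v) = lpi u + lpi v.
Proof. by rewrite -fl_addE. Qed.
Lemma lpiZ k u : lpi (EScale k u) = k *: lpi u.
Proof. by rewrite -fl_scaleE. Qed.

Lemma fl_br_linearl t : linear (fl_br^~ t).
Proof.
case: (free_lie_lpi t) => w -> k s s'.
case: (free_lie_lpi s) => u ->; case: (free_lie_lpi s') => v ->.
rewrite -lpiZ -lpiD !fl_brE -lpiZ -lpiD; apply/lpiP.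
by apply: lrel_trans (lrel_brDl _ _ _) _; apply: lrel_add;
  [exact: lrel_brZl|exact: lrel_refl].
Qed.

Lemma fl_br_linearr t : linear (fl_br t).
Proof.
case: (free_lie_lpi t) => w -> k s s'.
case: (free_lie_lpi s) => u ->; case: (free_lie_lpi s') => v ->.
rewrite -lpiZ -lpiD !fl_brE -lpiZ -lpiD; apply/lpiP.
by apply: lrel_trans (lrel_brDr _ _ _) _; apply: lrel_add;
  [exact: lrel_brZr|exact: lrel_refl].
Qed.

Lemma fl_brxx t : fl_br t t = 0.
Proof.
case: (free_lie_lpi t) => u ->.
by rewrite fl_brE -lpi0; apply/lpiP; exact: lrel_brxx.
Qed.

Lemma fl_jacobi s t r :
  fl_br s (fl_br t r) + fl_br t (fl_br r s) + fl_br r (fl_br s t) = 0.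
Proof.
case: (free_lie_lpi s) => u ->; case: (free_lie_lpi t) => v ->.
case: (free_lie_lpi r) => w ->.
by rewrite !fl_brE -!lpiD -lpi0; apply/lpiP; exact: lrel_jacobi.
Qed.

HB.instance Definition _ := Lmodule_isLieAlgebra.Build K free_lie
  fl_br_linearl fl_br_linearr fl_brxx fl_jacobi.

Lemma lpi_br u v : lpi (EBr u v) = [lie lpi u, lpi v].
Proof. by rewrite -fl_brE. Qed.

(* [homogeneous n t]: t lies in the degree n component, the span of the
   brackets of n generators. *)
Inductive homogeneous : nat -> free_lie -> Prop :=
| homogeneous_gen x : homogeneous 1 (gen x)
| homogeneous0 n : homogeneous n 0
| homogeneousD n s t :
    homogeneous n s -> homogeneous n t -> homogeneous n (s + t)
| homogeneousZ n k t : homogeneous n t -> homogeneous n (k *: t)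
| homogeneous_br m n s t :
    homogeneous m s -> homogeneous n t -> homogeneous (m + n) [lie s, t].

End FreeLie.

Section LieTheory.
Variables (K : comNzRingType) (L : lieAlgType K).
Implicit Types (u v w : L) (k : K).

Lemma liebDl u u' v : [lie u + u', v] = [lie u, v] + [lie u', v].
Proof. by have := lieb_linearl v 1 u u'; rewrite /= !scale1r. Qed.

Lemma liebDr u v v' : [lie u, v + v'] = [lie u, v] + [lie u, v'].
Proof. by have := lieb_linearr u 1 v v'; rewrite /= !scale1r. Qed.

Lemma lieb0l v : [lie 0, v] = 0 :> L.
Proof. by apply: (addrI [lie 0, v]); rewrite -liebDl !addr0. Qed.

Lemma lieb0r u : [lie u, 0] = 0 :> L.
Proof. by apply: (addrI [lie u, 0]); rewrite -liebDr !addr0. Qed.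

Lemma liebZl k u v : [lie k *: u, v] = k *: [lie u, v].
Proof. by have := lieb_linearl v k u 0; rewrite /= !addr0 lieb0l addr0. Qed.

Lemma liebZr k u v : [lie u, k *: v] = k *: [lie u, v].
Proof. by have := lieb_linearr u k v 0; rewrite /= !addr0 lieb0r addr0. Qed.

Lemma liebC u v : [lie u, v] = - [lie v, u].
Proof.
apply/eqP; rewrite -addr_eq0.
by have := liebxx (u + v); rewrite liebDl !liebDr !liebxx add0r addr0 => ->.
Qed.

End LieTheory.

Section UniversalProperty.
Variables (K : comNzRingType) (X : Type) (L : lieAlgType K) (f : X -> L).

Fixpoint lift_expr (u : lexpr K X) : L :=
  match u with
  | EGen x => f x
  | EZero => 0
  | EAdd u v => lift_expr u + lift_expr v
  | EScale k u => k *: lift_expr u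
  | EBr u v => [lie lift_expr u, lift_expr v]
  end.

Lemma lift_expr_lrel u v : lrel u v -> lift_expr u = lift_expr v.
Proof.
elim=> //= {u v}; try by move=> *; congruence.
- by move=> *; rewrite addrA.
- by move=> *; rewrite addrC.
- by move=> *; rewrite add0r.
- by move=> *; rewrite scaleN1r addNr.
- by move=> *; rewrite scalerA.
- by move=> *; rewrite scale1r.
- by move=> *; rewrite scalerDr.
- by move=> *; rewrite scalerDl.
- by move=> *; rewrite liebDl.
- by move=> *; rewrite liebDr.
- by move=> *; rewrite liebZl.
- by move=> *; rewrite liebZr.
- by move=> *; rewrite liebxx.
- by move=> *; rewrite lieb_jacobi.
Qed.

Theorem free_lie_universal :
  exists! F : free_lie K X -> L,
    [/\ linear F, {morph F : s t / [lie s, t]} & forall x, F (gen K x) = f x].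
Proof.
have liftE u : lift_expr (repr (lpi u)) = lift_expr u.
  by apply: lift_expr_lrel; apply/lpiP; rewrite reprK'.
exists (fun t => lift_expr (repr t)); split; first split.
- move=> k s t; case: (free_lie_lpi s) => u ->; case: (free_lie_lpi t) => v ->.
  by rewrite -lpiZ -lpiD !liftE.
- move=> s t; case: (free_lie_lpi s) => u ->; case: (free_lie_lpi t) => v ->.
  by rewrite -lpi_br !liftE.
- by move=> x; rewrite liftE.
move=> G [Gl Gb Gg]; apply/funext => t; case: (free_lie_lpi t) => u ->.
rewrite liftE; have G0 : G 0 = 0.
  by have /eqP := Gl (-1) 0 0; rewrite !scaleN1r oppr0 addr0 addNr => /eqP.
elim: u => [x||u IHu v IHv|k u IHu|u IHu v IHv] /=.
- by rewrite -Gg.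
- by rewrite -G0 lpi0.
- by rewrite IHu IHv lpiD -[lpi u]scale1r Gl !scale1r.
- by rewrite IHu lpiZ -[k *: lpi u]addr0 Gl G0 addr0.
- by rewrite IHu IHv lpi_br Gb.
Qed.

End UniversalProperty.

Section Derivation.
Variables (K : comNzRingType) (X : Type) (f : X -> free_lie K X).

Fixpoint der_expr (u : lexpr K X) : free_lie K X :=
  match u with
  | EGen x => f x
  | EZero => 0
  | EAdd u v => der_expr u + der_expr v
  | EScale k u => k *: der_expr u
  | EBr u v => [lie der_expr u, lpi v] + [lie lpi u, der_expr v]
  end.

Definition lie_der (t : free_lie K X) : free_lie K X := der_expr (repr t).

Lemma der_expr_lrel u v : lrel u v -> der_expr u = der_expr v.
Proof.
elim=> //= {u v}; try by move=> *; congruence.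
- move=> u u' v v' /lpiP ulu -> /lpiP vlv ->; by rewrite ulu vlv.
- by move=> *; rewrite addrA.
- by move=> *; rewrite addrC.
- by move=> *; rewrite add0r.
- by move=> *; rewrite scaleN1r addNr.
- by move=> *; rewrite scalerA.
- by move=> *; rewrite scale1r.
- by move=> *; rewrite scalerDr.
- by move=> *; rewrite scalerDl.
- by move=> *; rewrite lpiD !liebDl addrACA.
- by move=> *; rewrite lpiD !liebDr addrACA.
- by move=> *; rewrite lpiZ !liebZl scalerDr.
- by move=> *; rewrite lpiZ !liebZr scalerDr.
- by move=> *; rewrite [X in _ + X]liebC subrr.
- move=> u v w; rewrite !lpi_br !liebDr.
  rewrite [LHS](AC ((1*2)*(1*2)*(1*2)) ((1*6*8)*(2*4*9)*(3*5*7))) /=.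
  by rewrite !lieb_jacobi !addr0.
Qed.

Lemma lie_derE u : lie_der (lpi u) = der_expr u.
Proof. by apply: der_expr_lrel; apply/lpiP; rewrite reprK'. Qed.

Lemma lie_der_gen x : lie_der (gen K x) = f x.
Proof. by rewrite lie_derE. Qed.

Lemma lie_der_linear : linear lie_der.
Proof.
move=> k s t; case: (free_lie_lpi s) => u ->; case: (free_lie_lpi t) => v ->.
by rewrite -lpiZ -lpiD !lie_derE.
Qed.

Lemma lie_der_lieb s t :
  lie_der [lie s, t] = [lie lie_der s, t] + [lie s, lie_der t].
Proof.
case: (free_lie_lpi s) => u ->; case: (free_lie_lpi t) => v ->.
by rewrite -lpi_br !lie_derE.
Qed.

End Derivation.

Section Basis.
Variables (K : comNzRingType) (V : lmodType K).
Local Open Scope classical_set_scope.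

Definition lin_indep (n : nat) (B : n.-tuple V) : Prop :=
  forall k : 'I_n -> K,
    \sum_(i < n) k i *: tnth B i = 0 -> forall i, k i = 0.

Definition lin_span (n : nat) (B : n.-tuple V) : set V :=
  [set v | exists k : 'I_n -> K, v = \sum_(i < n) k i *: tnth B i].

Definition is_basis (S : set V) (n : nat) (B : n.-tuple V) : Prop :=
  lin_indep B /\ lin_span B = S.

Definition has_dim (S : set V) (n : nat) : Prop :=
  exists B : n.-tuple V, is_basis S B.

End Basis.

Variant letter := la | lb | lc.

Section Sl2Action.
Variable R : realType.
Local Notation C := R[i].
Local Notation L := (free_lie C letter).

Definition sl2 : set 'M[C]_2 := [set D | \tr D = 0].
Definition sl2_x : 'M[C]_2 := delta_mx 0 1.
Definition sl2_h : 'M[C]_2 := delta_mx 0 0 - delta_mx 1 1.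
Definition sl2_y : 'M[C]_2 := delta_mx 1 0.

Definition letter_sl2 (l : letter) : 'M[C]_2 :=
  match l with la => sl2_x | lb => sl2_h | lc => sl2_y end.

(* L_1 is the adjoint representation through a = x, b = h, c = y: a trace-zero
   matrix D is D 0 1 *: x + D 0 0 *: h + D 1 0 *: y. *)
Definition sl2_L1 (D : 'M[C]_2) : L :=
  D 0 1 *: gen C la + D 0 0 *: gen C lb + D 1 0 *: gen C lc.

Definition sl2_act (D : 'M[C]_2) : L -> L :=
  lie_der (fun l => sl2_L1 (D *m letter_sl2 l - letter_sl2 l *m D)).

Lemma sl2_actE D l :
  sl2_act D (gen C l) = sl2_L1 (D *m letter_sl2 l - letter_sl2 l *m D).
Proof. exact: lie_der_gen. Qed.

Ltac sl2_table := rewrite sl2_actE /sl2_L1 /= /sl2_x /sl2_h /sl2_y;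
  rewrite !(mxE, big_ord_recl, big_ord0) /=;
  rewrite ?(mulr0, mul0r, mulr1, mul1r, addr0, add0r, subr0, sub0r, subrr,
    scale0r, scale1r, scaleN1r, oppr0, mulrN1, mulN1r, opprK).

Lemma sl2_act_table :
  [/\ [/\ sl2_act sl2_x (gen C la) = 0,
          sl2_act sl2_x (gen C lb) = - 2%:R *: gen C la &
          sl2_act sl2_x (gen C lc) = gen C lb],
      [/\ sl2_act sl2_h (gen C la) = 2%:R *: gen C la,
          sl2_act sl2_h (gen C lb) = 0 &
          sl2_act sl2_h (gen C lc) = - 2%:R *: gen C lc] &
      [/\ sl2_act sl2_y (gen C la) = - gen C lb,
          sl2_act sl2_y (gen C lb) = 2%:R *: gen C lc &
          sl2_act sl2_y (gen C lc) = 0]].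
Proof.
by do ![split]; sl2_table; rewrite // -?opprD -?mulr2n.
Qed.

Definition lie_invariants (n : nat) : set L :=
  [set Z | homogeneous n Z /\
           forall D : 'M[C]_2, sl2 D -> sl2_act D Z = 0].

End Sl2Action.

Arguments lie_invariants R n%_N : clear implicits.

(* Main.v *)
Require Import Defs.
From HB Require Import structures.
From mathcomp Require Import all_boot all_order all_algebra.
From mathcomp Require Import boolp classical_sets functions reals complex.
From mathcomp Require Import ring zify.
Import Order.TTheory GRing.Theory Num.Theory.
Local Open Scope ring_scope.

Set Implicit Arguments.
Unset Strict Implicit.
Unset Printing Implicit Defensive.

(** The free Lie algebra L on a, b, c maps to the noncommutative power series
    in a, b, c with the commutator bracket; [magnus t w] is the coefficient of
    the word w in the image of t. The map commutes with derivations
    ([magnus_lie_der]), so the action of sl2 becomes an explicit operation on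
    coefficients of words.

    The passage back to L is the identity [lie_der_expansion]: if t is
    homogeneous, the derivation of L sending each generator x to f x takes t to
    the sum, over all words x w, of the coefficient of x w in t times the
    left-normed bracket [..[[f x, w_1], w_2].., w_n]. With f x = x it is the
    Dynkin-Specht-Wever theorem, which gives in characteristic 0 both the
    injectivity of the map in each degree ([magnus_homogeneous_eq0]) and the
    fact that t is a combination of left-normed brackets of the words that occur
    in t. With f fixing one generator x and killing the others, it rewrites an
    element of degree 1 in x by left-normed brackets that begin with x.

    Let Z be an invariant of degree 5. It is killed by h, so all its words have
    as many a as c: up to b^5, whose bracket is 0, they contain b once and a, c
    twice, or a, c once and b three times. Beginning the brackets with b in the
    first case and with a in the second one leaves ten brackets that span these
    weight zero elements ([weight_zero_span]). The coefficients of x.Z and y.Z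
    vanish at every word. Nine of them, together with the coefficient of baacc
    in Z, form a triangular system of linear forms with integer coefficients in
    the ten coordinates of Z. Hence an invariant in which baacc has coefficient
    0 is 0 ([invariant_eq0]), and the space of invariants has dimension at most
    1. Finally I5 is killed by sl2, because the image of I5 in the power series
    is, and the coefficient of baacc in I5 is -2.

    The finitely many integers that enter this argument, the coefficients of
    the ten brackets and of I5, are evaluated with polynomials represented by
    prefix trees. *)

(** * Noncommutative power series and the Magnus map *)

Section Series.
Variables (K : comNzRingType) (X : finType).

(** A series is the family of its coefficients. The multiplication recurses on
    the word in which the coefficient is taken: a letter x at the front of the
    word is absorbed either by the right factor, next to the constant term of
    the left one, or by the left factor, which is then replaced by [shift x P]. *)
Definition series : Type := seq X -> K.
HB.instance Definition _ := GRing.Lmodule.copy series (seq X -> K^o).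

Implicit Types (P Q S : series) (u v w : seq X) (x y : X) (k : K).

Lemma addsE P Q w : (P + Q) w = P w + Q w :> K. Proof. by []. Qed.
Lemma oppsE P w : (- P) w = - P w :> K. Proof. by []. Qed.
Lemma scalesE k P w : (k *: P) w = k * P w :> K. Proof. by []. Qed.
Lemma sumsE (I : Type) (r : seq I) (F : I -> series) w :
  (\sum_(i <- r) F i) w = \sum_(i <- r) (F i w : K).
Proof. by elim/big_rec2: _ => // i _ F' _ <-. Qed.

Definition shift x P : series := fun w => P (x :: w).

Fixpoint smul P Q w : K :=
  if w is x :: w' then P [::] * Q w + smul (shift x P) Q w' else P [::] * Q w.

Lemma smul_cons P Q x w :
  smul P Q (x :: w) = P [::] * Q (x :: w) + smul (shift x P) Q w.
Proof. by []. Qed.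

Lemma smulDl P P' Q : smul (P + P') Q = smul P Q + smul P' Q :> series.
Proof.
apply/funext => w; elim: w P P' => [|x w IH] P P'; first exact: mulrDl.
rewrite addsE !smul_cons (IH (shift x P) (shift x P')) !addsE; ring.
Qed.

Lemma smulZl k P Q : smul (k *: P) Q = k *: (smul P Q : series).
Proof.
apply/funext => w; elim: w P => [|x w IH] P; first exact/esym/mulrA.
rewrite scalesE !smul_cons (IH (shift x P)) !scalesE; ring.
Qed.

Lemma smulDr P Q Q' : smul P (Q + Q') = smul P Q + smul P Q' :> series.
Proof.
apply/funext => w; elim: w P => [|x w IH] P; first exact: mulrDr.
by rewrite addsE !smul_cons IH !addsE; ring.
Qed.

Lemma smulZr k P Q : smul P (k *: Q) = k *: (smul P Q : series).
Proof.
apply/funext => w; elim: w P => [|x w IH] P; first exact: mulrCA.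
by rewrite scalesE !smul_cons IH !scalesE; ring.
Qed.

Lemma smulBl P P' Q : smul (P - P') Q = (smul P Q : series) - smul P' Q.
Proof. by rewrite -scaleN1r smulDl smulZl scaleN1r. Qed.

Lemma smulBr P Q Q' : smul P (Q - Q') = (smul P Q : series) - smul P Q'.
Proof. by rewrite -scaleN1r smulDr smulZr scaleN1r. Qed.

Lemma smul0l Q : smul 0 Q = 0 :> series.
Proof. by rewrite -{1}(scale0r (0 : series)) smulZl scale0r. Qed.

Lemma shift_smul x P Q :
  shift x (smul P Q) = P [::] *: shift x Q + smul (shift x P) Q.
Proof. by []. Qed.

Lemma smulA P Q S : smul P (smul Q S) = smul (smul P Q) S :> series.
Proof.
apply/funext => w; elim: w P => [|x w IH] P; first exact: mulrA.
rewrite !smul_cons shift_smul smulDl smulZl addsE IH scalesE /=. ring.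
Qed.

Definition scomm P Q : series := (smul P Q : series) - smul Q P.

Lemma scomm_linearl Q : linear (scomm^~ Q).
Proof.
move=> k P P'; rewrite /scomm smulDl smulDr smulZl smulZr scalerBr.
by rewrite opprD addrACA.
Qed.

Lemma scomm_linearr P : linear (scomm P).
Proof.
move=> k Q Q'; rewrite /scomm smulDl smulDr smulZl smulZr scalerBr.
by rewrite opprD addrACA.
Qed.

Lemma scommxx P : scomm P P = 0.
Proof. exact: subrr. Qed.

Lemma scomm_jacobi P Q S :
  scomm P (scomm Q S) + scomm Q (scomm S P) + scomm S (scomm P Q) = 0.
Proof.
apply/funext=> w; rewrite /scomm !smulBl !smulBr !smulA.
by rewrite !(addsE, oppsE); transitivity (0 : K); first ring.
Qed.

HB.instance Definition _ := Lmodule_isLieAlgebra.Build K series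
  scomm_linearl scomm_linearr scommxx scomm_jacobi.

Lemma lieb_seriesE P Q : [lie P, Q] = (smul P Q : series) - smul Q P.
Proof. by []. Qed.

Definition sletter x : series := fun w => (w == [:: x])%:R.

Definition magnus : free_lie K X -> series :=
  fun t => lift_expr sletter (repr t).

Lemma magnusE e : magnus (lpi e) = lift_expr sletter e.
Proof. by apply: lift_expr_lrel; apply/lpiP; rewrite reprK'. Qed.

Lemma magnus_gen x : magnus (gen K x) = sletter x.
Proof. by rewrite magnusE. Qed.

Lemma magnus_linear : linear magnus.
Proof.
move=> k s t; case: (free_lie_lpi s) => u ->; case: (free_lie_lpi t) => v ->.
by rewrite -lpiZ -lpiD !magnusE.
Qed.

HB.instance Definition _ :=
  GRing.isLinear.Build K (free_lie K X) series *:%R magnus magnus_linear.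

Lemma magnus_lieb s t : magnus [lie s, t] = [lie magnus s, magnus t].
Proof.
case: (free_lie_lpi s) => u ->; case: (free_lie_lpi t) => v ->.
by rewrite -lpi_br !magnusE.
Qed.

Lemma magnus_nil t : magnus t [::] = 0.
Proof.
case: (free_lie_lpi t) => e ->; rewrite magnusE.
elim: e => [x||u IHu v IHv|k u IHu|u IHu v IHv] //=.
- by rewrite addsE IHu IHv addr0.
- by rewrite scalesE IHu mulr0.
- by rewrite lieb_seriesE addsE oppsE /= mulrC subrr.
Qed.

(** The derivation sending each letter y to the sum of the M y x times x. The
    coefficient of w in the image collects, for each position of w, the words
    in which the letter x found there is replaced by a letter y. *)
Variable M : X -> X -> K.

Fixpoint sder P w : K :=
  if w is x :: w' then \sum_y M y x * P (y :: w') + sder (shift x P) w' else 0.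

Lemma sder_cons P x w :
  sder P (x :: w) = \sum_y M y x * P (y :: w) + sder (shift x P) w.
Proof. by []. Qed.

Lemma sderD P Q : sder (P + Q) = sder P + sder Q :> series.
Proof.
apply/funext => w; elim: w P Q => [|x w IH] P Q; first exact/esym/addr0.
rewrite addsE !sder_cons (IH (shift x P) (shift x Q)) addsE addrACA -big_split.
by congr (_ + _); apply: eq_bigr => y _; rewrite addsE mulrDr.
Qed.

Lemma sderZ k P : sder (k *: P) = k *: (sder P : series).
Proof.
apply/funext => w; elim: w P => [|x w IH] P; first exact/esym/mulr0.
rewrite scalesE !sder_cons (IH (shift x P)) scalesE mulrDr mulr_sumr.
by congr (_ + _); apply: eq_bigr => y _; rewrite scalesE mulrCA.
Qed.

Lemma sderB P Q : sder (P - Q) = (sder P : series) - sder Q.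
Proof. by rewrite -scaleN1r sderD sderZ scaleN1r. Qed.

Lemma sder0 : sder 0 = 0 :> series.
Proof. by rewrite -{1}(scale0r (0 : series)) sderZ scale0r. Qed.

Lemma sder_lin_comb (I : Type) (r : seq I) (k : I -> K) (F : I -> series) :
  sder (\sum_(i <- r) k i *: F i) = \sum_(i <- r) k i *: (sder (F i) : series).
Proof.
elim: r => [|i r IH]; last by rewrite !big_cons sderD sderZ IH.
by rewrite !big_nil sder0.
Qed.

Lemma shift_sder x P :
  shift x (sder P) = \sum_y M y x *: shift y P + sder (shift x P).
Proof. by apply/funext => v; rewrite addsE sumsE. Qed.

Lemma sder_smul P Q :
  sder (smul P Q) = (smul (sder P) Q : series) + smul P (sder Q).
Proof.
apply/funext => w; elim: w P => [|x w IH] P.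
  by rewrite addsE /= mul0r mulr0 addr0.
rewrite sder_cons shift_smul sderD sderZ !addsE IH scalesE addsE.
rewrite [smul (sder P) _ _]smul_cons [sder P [::]]/= mul0r add0r.
rewrite [smul P _ _]smul_cons sder_cons shift_sder smulDl addsE.
have -> : smul (\sum_y M y x *: shift y P) Q w =
          \sum_y M y x * smul (shift y P) Q w.
  elim: (index_enum X) => [|y r IHr]; first by rewrite !big_nil smul0l.
  by rewrite !big_cons smulDl smulZl addsE scalesE IHr.
under eq_bigr do rewrite smul_cons mulrDr mulrCA.
rewrite big_split /= -mulr_sumr; ring.
Qed.

Lemma magnus_lie_der t :
  magnus (lie_der (fun y => \sum_x M y x *: gen K x) t) = sder (magnus t).
Proof.
case: (free_lie_lpi t) => e ->; rewrite lie_derE magnusE.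
elim: e => [x||u IHu v IHv|k u IHu|u IHu v IHv].
- rewrite [LHS]linear_sum; apply/funext => w; rewrite sumsE /=.
  under eq_bigr do rewrite linearZ /= scalesE magnus_gen /sletter.
  case: w => [|y w]; first by rewrite big1 // => y _; rewrite mulr0.
  rewrite sder_cons /shift /sletter.
  have -> : sder (fun w0 => ((y :: w0) == [:: x])%:R) w = 0.
    case: w => [//|z w]; rewrite sder_cons big1 => [|l _].
      rewrite add0r -[RHS](congr1 (@^~ w) sder0).
      by congr (sder _ w); apply/funext => v; rewrite /shift eqseq_cons andbF.
    by rewrite eqseq_cons andbF mulr0.
  rewrite addr0 (bigD1 y) //= [RHS](bigD1 x) //=.
  rewrite !eqseq_cons !eqxx /= !big1 => [//|l ne|l ne].
    by rewrite eqseq_cons (negbTE ne) mulr0.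
  by rewrite eqseq_cons eq_sym (negbTE ne) mulr0.
- by rewrite /= linear0 sder0.
- by rewrite /= linearD /= IHu IHv sderD.
- by rewrite /= linearZ /= IHu sderZ.
- rewrite /= linearD /= !magnus_lieb IHu IHv !magnusE !lieb_seriesE.
  rewrite sderB !sder_smul opprD [- smul (sder _) _ - _]addrC.
  exact: addrACA.
Qed.

End Series.

(** * Expansion of a derivation along the words of its argument *)

Section Expansion.
Variables (K : comNzRingType) (X : finType).
Local Notation L := (free_lie K X).
Implicit Types (P Q : series K X) (s t u : L) (w : seq X) (x y : X) (k : K).

HB.instance Definition _ (f : X -> L) :=
  GRing.isLinear.Build K L L *:%R (lie_der f) (lie_der_linear f).

(** Words act on L from the right by iterated brackets, u . x = [u, x]; the sum
    over the words of length n of P is taken one letter at a time. By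
    [ract_magnus] the image of t in the series acts as the bracket with t. *)
Fixpoint ract n u P : L :=
  if n is n'.+1 then \sum_x ract n' [lie u, gen K x] (shift x P)
  else P [::] *: u.

Lemma ractDr n u P Q : ract n u (P + Q) = ract n u P + ract n u Q.
Proof.
elim: n u P Q => [|n IH] u P Q; first exact: scalerDl.
by rewrite /= -big_split; apply: eq_bigr => x _; rewrite /= -IH.
Qed.

Lemma ractZr n k u P : ract n u (k *: P) = k *: ract n u P.
Proof.
elim: n u P => [|n IH] u P; first exact/esym/scalerA.
by rewrite /= scaler_sumr; apply: eq_bigr => x _; rewrite -IH.
Qed.

Lemma ractDl n u u' P : ract n (u + u') P = ract n u P + ract n u' P.
Proof.
elim: n u u' P => [|n IH] u u' P; first exact: scalerDr.
by rewrite /= -big_split; apply: eq_bigr => x _; rewrite liebDl IH.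
Qed.

Lemma ractZl n k u P : ract n (k *: u) P = k *: ract n u P.
Proof.
elim: n u P => [|n IH] u P; first by rewrite /= !scalerA mulrC.
by rewrite /= scaler_sumr; apply: eq_bigr => x _; rewrite liebZl IH.
Qed.

Lemma ractBr n u P Q : ract n u (P - Q) = ract n u P - ract n u Q.
Proof. by rewrite -scaleN1r ractDr ractZr scaleN1r. Qed.

Lemma ract0r n u : ract n u 0 = 0.
Proof. by rewrite -(scale0r 0) ractZr scale0r. Qed.

Lemma ract0l n P : ract n 0 P = 0.
Proof. by rewrite -{1}(scale0r (0 : L)) ractZl scale0r. Qed.

Lemma ract_suml n (F : X -> L) P :
  ract n (\sum_x F x) P = \sum_x ract n (F x) P.
Proof.
exact: (big_morph (ract n ^~ P) (fun s t => ractDl n s t P) (ract0l n P)).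
Qed.

Definition supported n P := forall w, size w != n -> P w = 0.

Lemma supported_shift n x P : supported n.+1 P -> supported n (shift x P).
Proof. by move=> sP w nw; apply: sP. Qed.

Lemma shift_supported0 x P : supported 0 P -> shift x P = 0.
Proof. by move=> sP; apply/funext => w; apply: sP. Qed.

Lemma supported_smul m n P Q :
  supported m P -> supported n Q -> supported (m + n)%N (smul P Q).
Proof.
move=> sP sQ w; elim: w m P sP => [|x w IH] [|m] P sP nw /=.
- by rewrite sQ // mulr0.
- by rewrite sP // mul0r.
- by rewrite (sQ (x :: w)) // shift_supported0 // smul0l mulr0 addr0.
- by rewrite sP // mul0r (IH m) ?addr0 //; apply: supported_shift.
Qed.

Lemma ract_smul m n u P Q :
  supported m P -> ract (m + n)%N u (smul P Q) = ract n (ract m u P) Q.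
Proof.
elim: m u P => [|m IH] u P sP /=.
  rewrite ractZl -ractZr; congr ract; apply/funext => -[//|x w].
  by rewrite smul_cons shift_supported0 // smul0l addr0.
rewrite ract_suml; apply: eq_bigr => x _; rewrite shift_smul sP // scale0r add0r.
exact/IH/supported_shift.
Qed.

Lemma magnus_supported n t : homogeneous n t -> supported n (magnus t).
Proof.
elim=> {n t} [x|n|n s t _ IHs _ IHt|n k t _ IHt|m n s t _ IHs _ IHt].
- by rewrite magnus_gen /sletter => -[|y [|z w]] //= _; rewrite eqseq_cons andbF.
- by rewrite linear0.
- by rewrite linearD => w nw; rewrite /= addsE IHs // IHt // addr0.
- by rewrite linearZ => w nw; rewrite /= scalesE IHt // mulr0.
- rewrite magnus_lieb lieb_seriesE => w nw; rewrite addsE oppsE.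
  rewrite (supported_smul IHs IHt nw) (supported_smul IHt IHs) ?subrr //.
  by rewrite addnC.
Qed.

(** On a bracket [s, t] this is the Jacobi identity, since the action of a
    product of series is the composite of the two actions. *)
Lemma ract_magnus n t :
  homogeneous n t -> forall u, ract n u (magnus t) = [lie u, t].
Proof.
elim=> {n t} [x|n|n s t _ IHs _ IHt|n k t _ IHt|m n s t hs IHs ht IHt] u.
- rewrite magnus_gen /= (bigD1 x) //= /shift /sletter eqxx scale1r.
  rewrite big1 ?addr0 // => y ne; rewrite eqseq_cons (negbTE ne) scale0r //.
- by rewrite linear0 ract0r lieb0r.
- by rewrite linearD /= ractDr IHs IHt liebDr.
- by rewrite linearZ /= ractZr IHt liebZr.
- rewrite magnus_lieb lieb_seriesE ractBr.
  rewrite ract_smul ?IHs ?IHt; last exact: magnus_supported.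
  rewrite addnC ract_smul ?IHs ?IHt; last exact: magnus_supported.
  have lieN v v' : [lie v, - v'] = - [lie v, v'] :> L.
    by rewrite -scaleN1r liebZr scaleN1r.
  rewrite (liebC [lie u, s]) (liebC [lie u, t]) (liebC u t) lieN opprK.
  by apply/eqP; rewrite eq_sym -subr_eq0 opprB opprK addrA lieb_jacobi.
Qed.

(** The linear extension of x w |-> (f x) . w to the words of length n; the
    empty word has no first letter and contributes 0. *)
Definition expand (f : X -> L) n P : L :=
  if n is n'.+1 then \sum_x ract n' (f x) (shift x P) else 0.

Lemma expandDr f n P Q : expand f n (P + Q) = expand f n P + expand f n Q.
Proof.
case: n => [|n]; first by rewrite /= addr0.
by rewrite /= -big_split; apply: eq_bigr => x _; rewrite /= -ractDr.
Qed.

Lemma expandZr f n k P : expand f n (k *: P) = k *: expand f n P.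
Proof.
case: n => [|n]; first by rewrite /= scaler0.
by rewrite /= scaler_sumr; apply: eq_bigr => x _; rewrite -ractZr.
Qed.

Lemma expandBr f n P Q : expand f n (P - Q) = expand f n P - expand f n Q.
Proof. by rewrite -scaleN1r expandDr expandZr scaleN1r. Qed.

Lemma expand0r f n : expand f n 0 = 0.
Proof. by rewrite -(scale0r 0) expandZr scale0r. Qed.

Lemma expand_smul f m n P Q : supported m P -> P [::] = 0 ->
  expand f (m + n)%N (smul P Q) = ract n (expand f m P) Q.
Proof.
case: m => [|m] sP P0 /=.
  have -> : P = 0 by apply/funext => -[//|x w]; apply: sP.
  by rewrite smul0l expand0r ract0l.
rewrite ract_suml; apply: eq_bigr => x _; rewrite shift_smul P0 scale0r add0r.
by apply/ract_smul/supported_shift.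
Qed.

(** Both sides are derivations in t with the same values on the generators. For
    the right-hand side, expanding a product s t gives the expansion of s acted
    on by t, that is its bracket with t ([ract_magnus]), so the commutator of s
    and t gives the Leibniz rule. *)
Theorem lie_der_expansion f n t :
  homogeneous n t -> lie_der f t = expand f n (magnus t).
Proof.
elim=> {n t} [x|n|n s t _ IHs _ IHt|n k t _ IHt|m n s t hs IHs ht IHt].
- rewrite lie_der_gen magnus_gen /= (bigD1 x) //= /shift /sletter eqxx scale1r.
  by rewrite big1 ?addr0 // => y ne; rewrite eqseq_cons (negbTE ne) scale0r.
- by rewrite !linear0 expand0r.
- by rewrite !linearD /= expandDr IHs IHt.
- by rewrite !linearZ /= expandZr IHt.
- rewrite lie_der_lieb magnus_lieb lieb_seriesE expandBr.
  have [sS sT] := (magnus_supported hs, magnus_supported ht).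
  rewrite (expand_smul _ _ _ sS (magnus_nil s)) addnC.
  rewrite (expand_smul _ _ _ sT (magnus_nil t)) (ract_magnus hs).
  by rewrite (ract_magnus ht) -IHs -IHt [X in _ - X]liebC opprK.
Qed.

Lemma lie_der_homogeneous n t :
  homogeneous n t -> lie_der (gen K (X:=X)) t = n%:R *: t.
Proof.
elim=> {n t} [x|n|n s t _ IHs _ IHt|n k t _ IHt|m n s t hs IHs ht IHt].
- by rewrite lie_der_gen scale1r.
- by rewrite linear0 scaler0.
- by rewrite linearD /= IHs IHt scalerDr.
- by rewrite linearZ /= IHt !scalerA mulrC.
- by rewrite lie_der_lieb IHs IHt liebZl liebZr natrD scalerDl.
Qed.

Lemma homogeneous_lie_der f n t : (forall x, homogeneous 1 (f x)) ->
  homogeneous n t -> homogeneous n (lie_der f t).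
Proof.
move=> hf.
elim=> {n t} [x|n|n s t _ IHs _ IHt|n k t _ IHt|m n s t hs IHs ht IHt].
- by rewrite lie_der_gen.
- by rewrite linear0; apply: homogeneous0.
- by rewrite linearD; apply: homogeneousD.
- by rewrite linearZ; apply: homogeneousZ.
- by rewrite lie_der_lieb; apply: homogeneousD; apply: homogeneous_br.
Qed.

Definition ladder u w : L := foldl (fun s x => [lie s, gen K x]) u w.

(** Only the words that occur in P matter for membership in a subspace S. *)
Lemma ract_closed (S : L -> Prop) n u P :
  S 0 -> (forall s t, S s -> S t -> S (s + t)) ->
  (forall k t, S t -> S (k *: t)) ->
  (forall w, size w = n -> P w != 0 -> S (ladder u w)) -> S (ract n u P).
Proof.
move=> S0 SD SZ; elim: n u P => [|n IH] u P SP /=.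
  have [->|nz] := eqVneq (P [::]) 0; first by rewrite scale0r.
  exact/SZ/(SP [::]).
elim/big_ind: _ => // x _; apply: IH => w sw nz.
by apply: (SP (x :: w)) => //=; rewrite sw.
Qed.

Lemma homogeneous_ladder n u w :
  homogeneous n u -> homogeneous (n + size w)%N (ladder u w).
Proof.
elim: w n u => [|x w IH] n u hu /=; first by rewrite addn0.
rewrite addnS -addSn; apply: IH; rewrite -addn1.
by apply: homogeneous_br => //; apply: homogeneous_gen.
Qed.

(** Weighting the letters by c grades L and the series, and the weight is an
    eigenvalue of the derivation x |-> c x. With c the indicator of a letter it
    counts that letter. *)
Lemma lie_der_ladder (c : X -> K) k u w :
  lie_der (fun x => c x *: gen K x) u = k *: u ->
  lie_der (fun x => c x *: gen K x) (ladder u w) =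
    (k + \sum_(x <- w) c x) *: ladder u w.
Proof.
elim: w k u => [|x w IH] k u Eu /=; first by rewrite big_nil addr0.
rewrite big_cons addrA; apply: IH.
by rewrite lie_der_lieb Eu lie_der_gen liebZl liebZr scalerDl.
Qed.

Lemma sder_diag (c : X -> K) P w :
  sder (fun y x => (x == y)%:R * c y) P w = (\sum_(x <- w) c x) * P w.
Proof.
elim: w P => [|x w IH] P; first by rewrite /= big_nil mul0r.
rewrite sder_cons IH big_cons mulrDl (bigD1 x) //= eqxx mul1r.
by rewrite big1 ?addr0 // => y ne; rewrite eq_sym (negbTE ne) !mul0r.
Qed.

Lemma magnus_grading (c : X -> K) t w :
  magnus (lie_der (fun x => c x *: gen K x) t) w =
    (\sum_(x <- w) c x) * magnus t w.
Proof.
rewrite -sder_diag -magnus_lie_der; congr (magnus (lie_der _ _) w).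
apply/funext => y; rewrite (bigD1 y) //= eqxx mul1r big1 ?addr0 // => x ne.
by rewrite (negbTE ne) mul0r scale0r.
Qed.

End Expansion.

(** * Integer coefficients by prefix trees *)

Definition code_letter (l : letter) : option bool :=
  match l with la => None | lb => Some false | lc => Some true end.
Definition decode_letter (o : option bool) : letter :=
  match o with None => la | Some false => lb | Some true => lc end.
Lemma code_letterK : cancel code_letter decode_letter. Proof. by case. Qed.

HB.instance Definition _ := Countable.copy letter (can_type code_letterK).

Lemma letter_enumP : Finite.axiom [:: la; lb; lc]. Proof. by case. Qed.
HB.instance Definition _ := isFinite.Build letter letter_enumP.

Lemma big_letter (V : nmodType) (F : letter -> V) :
  \sum_x F x = F la + F lb + F lc.
Proof.
rewrite (perm_big [:: la; lb; lc]) /= ?big_cons ?big_nil ?addr0 ?addrA //.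
by apply: uniq_perm; rewrite ?index_enum_uniq // => -[]; rewrite mem_index_enum.
Qed.

(** A noncommutative polynomial as the prefix tree of its words: a node holds
    the constant term and, for each letter x, the tree of the words that begin
    with x, stripped of it. The operations follow the recursions of [smul] and
    [sder], so they agree with them by induction on words. *)
Inductive tree := Leaf | Node of int & tree & tree & tree.

Definition child (l : letter) (t : tree) : tree :=
  match t, l with
  | Leaf, _ => Leaf
  | Node _ t' _ _, la => t'
  | Node _ _ t' _, lb => t'
  | Node _ _ _ t', lc => t'
  end.

Fixpoint tcoef (t : tree) (w : seq letter) : int :=
  match t, w with
  | Leaf, _ => 0
  | Node k _ _ _, [::] => k
  | Node _ ta tb tc, l :: w' =>
      tcoef (match l with la => ta | lb => tb | lc => tc end) w'
  end.

Fixpoint tadd (s t : tree) : tree :=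
  match s, t with
  | Leaf, _ => t
  | _, Leaf => s
  | Node k sa sb sc, Node l ta tb tc =>
      Node (k + l) (tadd sa ta) (tadd sb tb) (tadd sc tc)
  end.

Fixpoint tscale (k : int) (t : tree) : tree :=
  if t is Node l ta tb tc
  then Node (k * l) (tscale k ta) (tscale k tb) (tscale k tc) else Leaf.

(** Cutting off null branches keeps the trees of products sparse. *)
Definition tscale0 k t := if k == 0 then Leaf else tscale k t.

Fixpoint tmul (s t : tree) : tree :=
  if s is Node k sa sb sc
  then tadd (tscale0 k t) (Node 0 (tmul sa t) (tmul sb t) (tmul sc t)) else Leaf.

Definition tletter (l : letter) : tree :=
  let one := Node 1 Leaf Leaf Leaf in
  match l with
  | la => Node 0 one Leaf Leaf
  | lb => Node 0 Leaf one Leaf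
  | lc => Node 0 Leaf Leaf one
  end.

Fixpoint tree_of (e : lexpr int letter) : tree :=
  match e with
  | EGen l => tletter l
  | EZero => Leaf
  | EAdd u v => tadd (tree_of u) (tree_of v)
  | EScale k u => tscale0 k (tree_of u)
  | EBr u v => let s := tree_of u in let t := tree_of v in
      tadd (tmul s t) (tscale0 (-1) (tmul t s))
  end.

Fixpoint tder (M : letter -> letter -> int) (t : tree) : tree :=
  if t is Node _ ta tb tc then
    let sub l t' := tadd (tscale0 (M la l) ta)
      (tadd (tscale0 (M lb l) tb) (tadd (tscale0 (M lc l) tc) (tder M t'))) in
    Node 0 (sub la ta) (sub lb tb) (sub lc tc)
  else Leaf.

Fixpoint tnull (t : tree) : bool :=
  if t is Node k ta tb tc then [&& k == 0, tnull ta, tnull tb & tnull tc]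
  else true.

Section TreeSeries.
Variable K : comNzRingType.
Local Notation series := (series K letter).

Definition tser (t : tree) : series := fun w => (tcoef t w)%:~R.

Lemma tser_Leaf : tser Leaf = 0.
Proof. by apply/funext => -[]. Qed.

Lemma shift_tser l t : shift l (tser t) = tser (child l t).
Proof. by apply/funext => w; case: t => [|k ta tb tc]; case: l. Qed.

Lemma tser_tadd s t : tser (tadd s t) = tser s + tser t.
Proof.
apply/funext => w; rewrite addsE.
elim: w s t => [|l w IH] [|k sa sb sc] [|k' ta tb tc] //=;
  rewrite ?tser_Leaf ?addr0 ?add0r //; first by rewrite /tser /= intrD.
by case: l; apply: IH.
Qed.

Lemma tser_tscale k t : tser (tscale k t) = k%:~R *: tser t.
Proof.
apply/funext => w; rewrite scalesE.
elim: w t => [|l w IH] [|k' ta tb tc];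
  rewrite /= ?tser_Leaf ?[RHS]mulr0 //; first by rewrite /tser /= intrM.
by case: l; apply: IH.
Qed.

Lemma tser_tscale0 k t : tser (tscale0 k t) = k%:~R *: tser t.
Proof.
rewrite /tscale0; case: eqP => [->|_]; last exact: tser_tscale.
by rewrite scale0r tser_Leaf.
Qed.

Lemma tser_tmul s t : tser (tmul s t) = smul (tser s) (tser t).
Proof.
apply/funext => w; elim: w s => [|l w IH] [|k sa sb sc].
- by rewrite /= mul0r.
- by rewrite /= tser_tadd addsE tser_tscale0 scalesE addr0.
- by rewrite tser_Leaf smul0l.
- rewrite smul_cons shift_tser -IH /= tser_tadd addsE tser_tscale0 scalesE.
  by case: l.
Qed.

Lemma tser_tletter l : tser (tletter l) = sletter K l.
Proof.
by apply/funext => -[|x [|y w]]; case: l => //; case: x => //; case: y.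
Qed.

Lemma tser_tder M t : tser (tder M t) = sder (fun y x => (M y x)%:~R) (tser t).
Proof.
apply/funext => w; elim: w t => [|l w IH] [|k ta tb tc] //.
  rewrite sder_cons big1 ?shift_tser -?IH ?add0r //.
  by move=> y _; rewrite mulr0.
rewrite sder_cons shift_tser -IH big_letter.
have E l' t' : tser (tadd (tscale0 (M la l') ta)
      (tadd (tscale0 (M lb l') tb) (tadd (tscale0 (M lc l') tc) t'))) w =
  (M la l')%:~R * tser ta w + (M lb l')%:~R * tser tb w +
  (M lc l')%:~R * tser tc w + tser t' w.
  by rewrite !tser_tadd !addsE !tser_tscale0 !scalesE !addrA.
by case: l; apply: E.
Qed.

Lemma tnullP t : tnull t -> tser t = 0.
Proof.
move=> nt; apply/funext => w.
elim: w t nt => [|l w IH] [|k ta tb tc] //= /and4P[/eqP-> na nb nc] //.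
by case: l; apply: IH.
Qed.

Fixpoint eval_expr (e : lexpr int letter) : free_lie K letter :=
  match e with
  | EGen l => gen K l
  | EZero => 0
  | EAdd u v => eval_expr u + eval_expr v
  | EScale k u => k%:~R *: eval_expr u
  | EBr u v => [lie eval_expr u, eval_expr v]
  end.

Lemma magnus_eval e : magnus (eval_expr e) = tser (tree_of e).
Proof.
elim: e => [l||u IHu v IHv|k u IHu|u IHu v IHv] /=.
- by rewrite magnus_gen tser_tletter.
- by rewrite linear0 tser_Leaf.
- by rewrite linearD /= IHu IHv tser_tadd.
- by rewrite linearZ /= IHu tser_tscale0.
- rewrite magnus_lieb IHu IHv lieb_seriesE tser_tadd tser_tscale0 !tser_tmul.
  by rewrite scaleN1r.
Qed.

Lemma sder_lincomb (p q r : K) (A B C M : letter -> letter -> K) P :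
  (forall y x, M y x = p * A y x + q * B y x + r * C y x) ->
  sder M P = p *: (sder A P : series) + q *: (sder B P : series) +
             r *: (sder C P : series).
Proof.
move=> ME; apply/funext => w; rewrite !addsE !scalesE.
elim: w P => [|l w IH] P; first by rewrite /= !mulr0 !addr0.
rewrite !sder_cons IH !big_letter !ME; ring.
Qed.

End TreeSeries.

(** * The action of sl2 on coefficients *)

(** The matrix of ad (p x + q h + r y) on the letters a = x, b = h, c = y. *)
Definition ad_coef (K : pzRingType) (p q r : K) (y x : letter) : K :=
  match y, x with
  | la, la => 2%:R * q | la, lb => - r
  | lb, la => - (2%:R * p) | lb, lc => 2%:R * r
  | lc, lb => p | lc, lc => - (2%:R * q)
  | _, _ => 0
  end.

Lemma ad_coef_int (K : pzRingType) (p q r : int) :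
  ad_coef p%:~R q%:~R r%:~R = fun y x => (ad_coef p q r y x)%:~R :> K.
Proof.
by apply/funext => -[]; apply/funext => -[] /=; rewrite ?rmorphN ?rmorphM.
Qed.

Section Sl2.
Variable R : realType.
Local Notation C := R[i].
Local Notation L := (free_lie C letter).

Lemma magnus_sl2_act (D : 'M[C]_2) (t : L) : sl2 D ->
  magnus (sl2_act D t) = sder (ad_coef (D 0 1) (D 0 0) (D 1 0)) (magnus t).
Proof.
rewrite /sl2 /= /mxtrace big_ord_recl big_ord1 => trD.
have lift01 : lift 0 0 = 1 :> 'I_2 by apply/val_inj.
have D11 : D 1 1 = - D 0 0 by apply/eqP; rewrite -addr_eq0 addrC -lift01 trD.
rewrite -magnus_lie_der /sl2_act; congr (magnus (lie_der _ _)).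
apply/funext => l; rewrite big_letter /sl2_L1; congr (_ *: _ + _ *: _ + _ *: _);
  case: l; rewrite /= /sl2_x /sl2_h /sl2_y !(mxE, big_ord_recl, big_ord0) /=;
  rewrite -?[ord0]/(0 : 'I_2) ?lift01 ?D11; ring.
Qed.

End Sl2.

(** * The triangular system *)

(** Forward substitution: the first form involves only the unknown of its own
    pivot, which therefore vanishes and drops out of the remaining rows. *)
Lemma triangular_eq0 (K : numDomainType) (J I : eqType) (A : J -> I -> int)
    (rows : seq (J * I)) (z : I -> K) :
  pairwise (fun r s => A r.1 s.2 == 0) rows ->
  all (fun r => A r.1 r.2 != 0) rows ->
  {in rows, forall r, \sum_(s <- rows) (A r.1 s.2)%:~R * z s.2 = 0} ->
  {in rows, forall r, z r.2 = 0}.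
Proof.
elim: rows => [//|r rows IH] /= /andP[Ar0 tri] /andP[Arr piv] eqs.
have zr : z r.2 = 0.
  have := eqs r (mem_head _ _); rewrite big_cons big_seq big1 => [|s srows].
    by rewrite addr0 => /eqP; rewrite mulf_eq0 intr_eq0 (negbTE Arr) => /eqP.
  by rewrite (eqP (allP Ar0 _ srows)) mul0r.
move=> s; rewrite inE => /predU1P[->//|]; apply: IH => // {}s srows.
by have := eqs s; rewrite inE srows orbT big_cons zr mulr0 add0r; apply.
Qed.

(** The left-normed bracket of a nonempty word, here as an expression whose
    coefficients can be computed and in [lnb] as an element of L. *)
Definition lnb_expr (v : seq letter) : lexpr int letter :=
  foldl (fun e x => EBr e (EGen _ x)) (EGen _ (head lb v)) (behead v).

Definition lnb (K : comNzRingType) (v : seq letter) : free_lie K letter :=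
  ladder (gen K (head lb v)) (behead v).

Lemma eval_lnb (K : comNzRingType) v : eval_expr K (lnb_expr v) = lnb K v.
Proof.
rewrite /lnb /lnb_expr /ladder -[gen K _]/(eval_expr K (EGen _ _)).
by elim: (behead v) (EGen _ _) => [//|x w IH] e; rewrite /= IH.
Qed.

(** The coefficient of a word in the bracket of v, after the action of
    p x + q h + r y when the first component is [Some (p, q, r)]. *)
Definition probe (k : option (int * int * int) * seq letter)
    (v : seq letter) : int :=
  let t := tree_of (lnb_expr v) in
  tcoef (if k.1 is Some (p, q, r) then tder (ad_coef p q r) t else t) k.2.

Definition baacc : seq letter := [:: lb; la; la; lc; lc].

Definition opX : option (int * int * int) := Some (1, 0, 0).
Definition opY : option (int * int * int) := Some (0, 0, 1).

(** The pivots are the ten brackets that span the elements of weight zero in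
    degree 5: b followed by the arrangements of a, a, c, c, and a followed by
    those of b, b, b, c. The words at which x.Z and y.Z are read are chosen, and
    ordered, so as to make the system triangular. The row of baacc normalizes Z:
    without it the invariants themselves solve the system. *)
Definition rows : seq (option (int * int * int) * seq letter * seq letter) :=
  [:: (opX, [:: la; lc; la; la; lc], [:: lb; lc; la; la; lc]);
      (opY, [:: la; lc; lc; la; lc], [:: lb; la; lc; lc; la]);
      (opY, [:: lb; lb; lb; lb; lc], [:: la; lc; lb; lb; lb]);
      (opY, [:: lc; lb; lb; lc; la], [:: la; lb; lb; lb; lc]);
      (None, baacc, baacc);
      (opX, [:: lb; la; la; lc; lb], [:: la; lb; lb; lc; lb]);
      (opX, [:: lb; la; lb; lb; lb], [:: la; lb; lc; lb; lb]);
      (opX, [:: lb; la; lc; la; lb], [:: lb; la; lc; la; lc]);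
      (opX, [:: lb; la; lc; lb; la], [:: lb; lc; la; lc; la]);
      (opX, [:: lb; lb; lc; la; la], [:: lb; lc; lc; la; la])].

Lemma rows_triangular : pairwise (fun r s => probe r.1 s.2 == 0) rows.
Proof. by vm_compute. Qed.
Lemma rows_pivot : all (fun r => probe r.1 r.2 != 0) rows.
Proof. by vm_compute. Qed.

Lemma rows_id :
  all (fun r => (r.1.1 == None) ==> (r.1.2 == baacc)) rows.
Proof. by []. Qed.

Definition pivots : seq (seq letter) := map snd rows.

(** * Invariants of degree 5 *)

Section Invariants.
Variable R : realType.
Local Notation C := R[i].
Local Notation L := (free_lie C letter).

Lemma sl2_actZD (D : 'M[C]_2) k (s t : L) :
  sl2_act D (k *: s + t) = k *: sl2_act D s + sl2_act D t.
Proof. exact: lie_der_linear. Qed.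

Lemma invariant0 n : lie_invariants R n 0.
Proof. by split=> [|D _]; [apply: homogeneous0 | apply: linear0]. Qed.

Lemma invariantZD n k (s t : L) : lie_invariants R n s ->
  lie_invariants R n t -> lie_invariants R n (k *: s + t).
Proof.
move=> [hs Ds] [ht Dt]; split=> [|D trD].
  by apply: homogeneousD ht; apply: homogeneousZ.
by rewrite sl2_actZD Ds // Dt // scaler0 addr0.
Qed.

(** The Dynkin expansion recovers n.+1 times t from its coefficients. *)
Lemma magnus_homogeneous_eq0 n (t : L) :
  homogeneous n.+1 t -> magnus t = 0 -> t = 0.
Proof.
move=> ht t0; have := lie_der_expansion (@gen C letter) ht.
rewrite t0 expand0r (lie_der_homogeneous ht) => /eqP.
by rewrite scaler_eq0 pnatr_eq0 /= => /eqP.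
Qed.

Lemma sl2_xP : sl2 (sl2_x R).
Proof. by rewrite /sl2 /= /mxtrace !big_ord_recl big_ord0 !mxE /= !addr0. Qed.
Lemma sl2_hP : sl2 (sl2_h R).
Proof.
rewrite /sl2 /= /mxtrace !big_ord_recl big_ord0 !mxE /=.
by rewrite addr0 subr0 sub0r subrr.
Qed.
Lemma sl2_yP : sl2 (sl2_y R).
Proof. by rewrite /sl2 /= /mxtrace !big_ord_recl big_ord0 !mxE /= !addr0. Qed.

Definition sl2_mx (p q r : C) : 'M[C]_2 :=
  p *: sl2_x R + q *: sl2_h R + r *: sl2_y R.

Lemma sder_invariant n (t : L) (p q r : C) :
  lie_invariants R n t -> sder (ad_coef p q r) (magnus t) = 0.
Proof.
move=> [_ inv]; have mxP : sl2 (sl2_mx p q r).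
  rewrite /sl2_mx /sl2 /= !mxtraceD !mxtraceZ.
  by rewrite (sl2_xP : _ = _) (sl2_hP : _ = _) (sl2_yP : _ = _) !mulr0 !addr0.
have := magnus_sl2_act t mxP; rewrite inv // linear0 => /esym.
rewrite /sl2_mx /sl2_x /sl2_h /sl2_y !mxE /=.
by rewrite !(mulr1, mulr0, subr0, addr0, add0r).
Qed.

(** An element of degree 1 in the letter l is its own image under the derivation
    that fixes l and kills the other letters; the expansion of that derivation
    only contains brackets beginning with l. *)
Lemma lnb_span (l : letter) (S : L -> Prop) n (t : L) :
  S 0 -> (forall s t, S s -> S t -> S (s + t)) ->
  (forall k t, S t -> S (k *: t)) ->
  homogeneous n.+1 t ->
  lie_der (fun x => (x == l)%:R *: gen C x) t = t ->
  (forall w, size w = n -> magnus t (l :: w) != 0 -> S (lnb C (l :: w))) -> S t.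
Proof.
move=> S0 SD SZ ht Et Sw; rewrite -Et (lie_der_expansion _ ht) /= (bigD1 l) //=.
rewrite eqxx scale1r big1 ?addr0 => [|x ne].
  by apply: ract_closed.
by rewrite (negbTE ne) scale0r ract0l.
Qed.

Lemma sum_count (l : letter) w :
  \sum_(x <- w) (x == l)%:R = (count_mem l w)%:R :> C.
Proof.
by elim: w => [|x w IH]; rewrite ?big_nil // big_cons IH -natrD.
Qed.

Lemma lnb_count l v : size v = 5%N ->
  lie_der (fun x => (x == l)%:R *: gen C x) (lnb C v) =
    (count_mem l v)%:R *: lnb C v.
Proof.
case: v => [//|y w] _; rewrite /lnb /= (@lie_der_ladder _ _ _ (y == l)%:R).
  by rewrite sum_count natrD.
exact: lie_der_gen.
Qed.

Lemma lnb_homogeneous v : size v = 5%N -> homogeneous 5 (lnb C v).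
Proof.
case: v => [//|y w] [sw].
by have := homogeneous_ladder w (homogeneous_gen C y); rewrite sw.
Qed.

Lemma magnus_lnb_count l v u : size v = 5%N -> magnus (lnb C v) u != 0 ->
  count_mem l u = count_mem l v.
Proof.
move=> sv nz; have := magnus_grading (fun x => (x == l)%:R) (lnb C v) u.
rewrite lnb_count // linearZ /= scalesE sum_count => /eqP.
by rewrite (inj_eq (mulIf nz)) eqr_nat => /eqP.
Qed.

(** Stated for an arbitrary subspace S, as an induction principle. The Dynkin
    expansion of t leaves the brackets of words with as many a as c; by degree,
    b or a occurs exactly once in such a word other than b^5, and the bracket is
    rewritten to begin with that letter. *)
Lemma weight_zero_span (S : L -> Prop) (t : L) :
  S 0 -> (forall s t, S s -> S t -> S (s + t)) ->
  (forall k t, S t -> S (k *: t)) -> (forall v, v \in pivots -> S (lnb C v)) ->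
  lie_invariants R 5 t -> S t.
Proof.
move=> S0 SD SZ Spiv inv.
have Ssplit l v : size v = 5%N -> count_mem l v = 1%N ->
    (forall w, size w = 4%N ->
      (forall m, count_mem m (l :: w) = count_mem m v) -> l :: w \in pivots) ->
    S (lnb C v).
  move=> sv cv piv; apply: (lnb_span (l := l) (n := 4)) => //.
  - exact: lnb_homogeneous.
  - by rewrite lnb_count // cv scale1r.
  - by move=> w sw nz; apply/Spiv/piv => // m; apply: magnus_lnb_count nz.
have Slnb v : size v = 5%N -> count_mem la v = count_mem lc v -> S (lnb C v).
  move=> sv bal.
  have : (count_mem la v + count_mem lb v + count_mem lc v = 5)%N.
    rewrite -{}sv {bal}; elim: v => [//|x v /= <-]; case: x; rewrite /=; lia.
  (* The number of a is 0, 1 or 2: the word b^5, a single a, a single b. *)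
  case ca: (count_mem la v) => [|[|k]] cv.
  - rewrite ca in bal.
    case: v sv ca bal {cv} => [|x [|y [|z1 [|z2 [|z3 [|]]]]]] // _.
    by case: x => //; case: y => // _ _; rewrite /lnb /ladder /= liebxx !lieb0l.
  - apply: (Ssplit la) => // -[|x1 [|x2 [|x3 [|x4 [|]]]]] // _ cw.
    move: (cw la) (cw lc); rewrite -bal ca.
    by move: x1 x2 x3 x4 {cw} => [] [] [] [].
  - have [k0 cb] : k = 0%N /\ count_mem lb v = 1%N by lia.
    apply: (Ssplit lb) => // -[|x1 [|x2 [|x3 [|x4 [|]]]]] // _ cw.
    move: (cw la) (cw lc); rewrite -bal ca k0.
    by move: x1 x2 x3 x4 {cw} => [] [] [] [].
have ht := inv.1; have h5 : 5%:R *: t = expand (@gen C letter) 5 (magnus t).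
  by rewrite -(lie_der_homogeneous ht) (lie_der_expansion _ ht).
have -> : t = 5%:R^-1 *: (5%:R *: t).
  by rewrite scalerA mulVf ?scale1r ?pnatr_eq0.
rewrite h5 /=; apply: (SZ); elim/big_ind: _ => // l _.
apply: (ract_closed (n := 4) S0 SD SZ) => w sw nz.
apply: (Slnb (l :: w)); first by rewrite /= sw.
(* The words of t have weight 0, because h kills t. *)
pose wt (x : letter) : C :=
  match x with la => 2%:R | lb => 0 | lc => - 2%:R end.
have := congr1 (@^~ (l :: w)) (sder_invariant 0 1 0 inv).
have -> : ad_coef 0 1 0 = (fun y x => (x == y)%:R * wt y).
  apply/funext => -[]; apply/funext => -[];
  by rewrite /wt /= ?mulr1 ?mul1r ?mul0r ?mulr0 ?oppr0.
rewrite sder_diag => /eqP; rewrite mulf_eq0 (negbTE nz) orbF.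
have -> : \sum_(x <- l :: w) wt x =
    2%:R * ((count_mem la (l :: w))%:R - (count_mem lc (l :: w))%:R).
  elim: (l :: w) => [|x v IH]; first by rewrite big_nil subrr mulr0.
  by rewrite big_cons IH /= !natrD; case: x; rewrite /wt /=; ring.
by rewrite mulf_eq0 pnatr_eq0 /= subr_eq0 eqr_nat => /eqP.
Qed.

(** The coordinates of t on the ten pivots satisfy the triangular system. *)
Lemma invariant_eq0 (t : L) : lie_invariants R 5 t ->
  magnus t baacc = 0 -> t = 0.
Proof.
move=> inv t0.
have [z tE] : exists z, t = \sum_(v <- pivots) z v *: lnb C v.
  move: inv; apply: (weight_zero_span
    (S := fun t => exists z, t = \sum_(v <- pivots) z v *: lnb C v)).
  - by exists (fun=> 0); rewrite big1 // => v _; rewrite scale0r.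
  - move=> _ _ [y ->] [z ->]; exists (fun v => y v + z v).
    by rewrite -big_split; apply: eq_bigr => v _; rewrite scalerDl.
  - move=> k _ [z ->]; exists (fun v => k * z v).
    by rewrite scaler_sumr; apply: eq_bigr => v _; rewrite scalerA.
  - move=> v pv; exists (fun u => (u == v)%:R).
    rewrite (bigD1_seq v) //= eqxx scale1r big1 ?addr0 // => u ne.
    by rewrite (negbTE ne) scale0r.
have tree_sum : magnus t =
    \sum_(v <- pivots) z v *: tser C (tree_of (lnb_expr v)).
  rewrite tE linear_sum; apply: eq_bigr => v _.
  by rewrite linearZ /= -eval_lnb magnus_eval.
have z0 : {in rows, forall r, z r.2 = 0}.
  apply: triangular_eq0 rows_triangular rows_pivot _ => -[[k u] v] rr.
  rewrite -(big_map snd xpredT (fun v => (probe (k, u) v)%:~R * z v)) -/pivots.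
  case: k rr => [[[p q] r]|] rr.
    have := congr1 (@^~ u) (sder_invariant p%:~R q%:~R r%:~R inv).
    rewrite tree_sum sder_lin_comb sumsE ad_coef_int => E; rewrite -[RHS]E.
    by apply: eq_bigr => w _; rewrite scalesE -tser_tder mulrC.
  have := allP rows_id _ rr; rewrite /= => /eqP ->.
  rewrite -[RHS]t0 tree_sum sumsE; apply: eq_bigr => w _.
  by rewrite scalesE mulrC.
rewrite tE /pivots big_map big_seq big1 // => r /z0 ->.
by rewrite scale0r.
Qed.

Definition I5_expr : lexpr int letter :=
  let a := EGen _ la in let b := EGen _ lb in let c := EGen _ lc in
  EAdd (EAdd (EAdd (EAdd (EAdd
    (EBr (EBr (EBr b a) b) (EBr c b))
    (EScale 4 (EBr (EBr (EBr b a) c) (EBr c a))))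
    (EScale 2 (EBr (EBr (EBr c a) a) (EBr c b))))
    (EScale (-2) (EBr (EBr (EBr c a) b) (EBr c a))))
    (EScale (-2) (EBr (EBr (EBr c a) c) (EBr b a))))
    (EScale (-1) (EBr (EBr (EBr c b) b) (EBr b a))).

Lemma I5_killed : [&& tnull (tder (ad_coef 1 0 0) (tree_of I5_expr)),
  tnull (tder (ad_coef 0 1 0) (tree_of I5_expr)) &
  tnull (tder (ad_coef 0 0 1) (tree_of I5_expr))].
Proof. by vm_compute. Qed.

Lemma I5_coef : tcoef (tree_of I5_expr) baacc = - 2%:Z.
Proof. by vm_compute. Qed.

(** Injectivity of the Magnus map in degree 5 reduces the claim to the images of
    I5 under x, h and y in the series. *)
Lemma I5_invariant : lie_invariants R 5 (eval_expr C I5_expr).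
Proof.
have h5 : homogeneous 5 (eval_expr C I5_expr).
  do ?[exact: homogeneous_gen | apply: homogeneousD | apply: homogeneousZ
    | apply: (@homogeneous_br _ _ 3 2) | apply: (@homogeneous_br _ _ 2 1)
    | apply: (@homogeneous_br _ _ 1 1)].
split=> // D trD; apply: (magnus_homogeneous_eq0 (n := 4)).
  apply: homogeneous_lie_der h5 => l; rewrite /sl2_L1.
  by do ?apply: homogeneousD; apply: homogeneousZ; apply: homogeneous_gen.
rewrite magnus_sl2_act // magnus_eval.
rewrite (sder_lincomb (A := fun y x => (ad_coef 1 0 0 y x)%:~R)
  (B := fun y x => (ad_coef 0 1 0 y x)%:~R)
  (C := fun y x => (ad_coef 0 0 1 y x)%:~R)
  (p := D 0 1) (q := D 0 0) (r := D 1 0)).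
  rewrite -!tser_tder; case/and3P: I5_killed => *.
  by rewrite !tnullP // !scaler0 !addr0.
case=> -[] /=; rewrite ?(rmorphN, rmorphM, rmorph0, rmorph1) /=; ring.
Qed.

Lemma I5_baacc : magnus (eval_expr C I5_expr) baacc = - 2%:R.
Proof. by rewrite magnus_eval /tser I5_coef rmorphN. Qed.

End Invariants.

Theorem theorem15 (R : realType) :
  let a := gen R[i] la in
  let b := gen R[i] lb in
  let c := gen R[i] lc in
  let I5 :=
      [lie [lie [lie b, a], b], [lie c, b]]
    + 4%:R *: [lie [lie [lie b, a], c], [lie c, a]]
    + 2%:R *: [lie [lie [lie c, a], a], [lie c, b]]
    - 2%:R *: [lie [lie [lie c, a], b], [lie c, a]]
    - 2%:R *: [lie [lie [lie c, a], c], [lie b, a]]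
    - [lie [lie [lie c, b], b], [lie b, a]] in
  has_dim (lie_invariants R 5) 1 /\ is_basis (lie_invariants R 5) [tuple I5].
Proof.
move=> a b c I5.
have I5E : I5 = eval_expr R[i] I5_expr.
  by rewrite /I5 /= !rmorphN !rmorph_nat !scaleNr !scale1r.
suff basis : is_basis (lie_invariants R 5) [tuple I5].
  by split=> //; exists [tuple I5].
have invI5 : lie_invariants R 5 I5 by rewrite I5E; apply: I5_invariant.
have two0 : - 2%:R != 0 :> R[i] by rewrite oppr_eq0 pnatr_eq0.
have top : magnus I5 baacc = - 2%:R by rewrite I5E I5_baacc.
split=> [k|].
  rewrite big_ord1 [tnth _ _]/= => kI i; rewrite (ord1 i).
  have := congr1 (@magnus _ _ ^~ baacc) kI.
  rewrite /= linearZ linear0 /= scalesE top => /eqP.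
  by rewrite mulf_eq0 (negbTE two0) orbF => /eqP.
apply/seteqP; split=> t /=.
  move=> [k ->]; rewrite big_ord1 [tnth _ _]/= -[_ *: _]addr0.
  exact/invariantZD/invariant0.
move=> inv; pose k := magnus t baacc / - 2%:R.
exists (fun=> k); rewrite big_ord1 [tnth _ _]/=; apply/eqP; rewrite -subr_eq0.
rewrite -scaleNr addrC; apply/eqP/invariant_eq0; first exact: invariantZD.
by rewrite linearD linearZ /= addsE scalesE top mulNr divfK // addNr.
Qed.
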